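(* Let $\delta\in(0,n]$, $p\in[1,\infty)$ and $w\in\mathcal A_{p,\delta}$. Then there exists a positive constant $K(p)$, depending only on $p$, such that for every $f\in L^1_w(\mathbb R^n,\mathcal H^\delta_\infty)$, $$\frac14\int_{\mathbb R^n}|f(x)|w(x)\,d\mathcal H^\delta_\infty\le\int_{\mathbb R^n}|f(x)|\,dw_{\mathcal H^\delta_\infty}\le K(p)\,[w]_{\mathcal A_{p,\delta}}^{\frac1p}\int_{\mathbb R^n}|f(x)|w(x)\,d\mathcal H^\delta_\infty.$$
   Context: A cube $Q\subset\mathbb R^n$ is a left-open right-closed cube with sides parallel to the axes; $l(Q)$ is its edge length. For $\delta\in(0,n]$ and $E\subset\mathbb R^n$, the Hausdorff content is $\mathcal H^\delta_\infty(E):=\inf\{\sum_i l(Q_i)^\delta:\ E\subset\bigcup_i Q_i\}$, the infimum over all finite or countable coverings of $E$ by cubes. For a non-negative, monotone, countably subadditive set function $C$ defined on all subsets of $\mathbb R^n$ with $C(\emptyset)=0$ (a capacity), $E\subset\mathbb R^n$ and a non-negative function $g$ (no measurability required), the Choquet integral is $\int_E g\,dC:=\int_0^\infty C(\{x\in E: g(x)>t\})\,dt$; this is applied with $C=\mathcal H^\delta_\infty$ and $C=w_{\mathcal H^\delta_\infty}$, where $w_{\mathcal H^\delta_\infty}(F):=\int_F w\,d\mathcal H^\delta_\infty$ for $F\subset\mathbb R^n$. ''Almost everywhere'' with respect to $\mathcal H^\delta_\infty$ means outside a set of zero $\mathcal H^\delta_\infty$-content. A capacitary weight is a non-negative function $w$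 with $\int_E w\,d\mathcal H^\delta_\infty<\infty$ for all compact $E$ and $w\in(0,\infty)$ $\mathcal H^\delta_\infty$-almost everywhere. $L^1_w(\mathbb R^n,\mathcal H^\delta_\infty)$ is the set of functions $f$ with $\int_{\mathbb R^n}|f|w\,d\mathcal H^\delta_\infty<\infty$. For $p\in(1,\infty)$, $w\in\mathcal A_{p,\delta}$ means $w$ is a capacitary weight with $[w]_{\mathcal A_{p,\delta}}:=\sup_Q\{\frac1{\mathcal H^\delta_\infty(Q)}\int_Qw\,d\mathcal H^\delta_\infty\}\{\frac1{\mathcal H^\delta_\infty(Q)}\int_Qw^{-\frac1{p-1}}d\mathcal H^\delta_\infty\}^{p-1}<\infty$ (supremum over all cubes). $w\in\mathcal A_{1,\delta}$ means $w$ is a capacitary weight with $[w]_{\mathcal A_{1,\delta}}:=\inf\{K\in(0,\infty):\ \mathcal M_{\mathcal H^\delta_\infty}w\le Kw\ \ \mathcal H^\delta_\infty\text{-a.e.}\}<\infty$, where $\mathcal M_{\mathcal H^\delta_\infty}f(x):=\sup_{Q\ni x}\frac1{\mathcal H^\delta_\infty(Q)}\int_Q|f|\,d\mathcal H^\delta_\infty$, the supremum over all cubes containing $x$. *)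

(* Defs.v *)
From HB Require Import structures.
From mathcomp Require Import all_boot all_order all_algebra.
From mathcomp Require Import all_classical all_reals all_analysis.
Set Implicit Arguments.
Unset Strict Implicit.
Unset Printing Implicit Defensive.
Import Order.TTheory GRing.Theory Num.Theory.
Import numFieldNormedType.Exports.
Local Open Scope classical_set_scope.
Local Open Scope ring_scope.
Local Open Scope ereal_scope.

(* R^n is 'rV[R]_n. Weights and functions take values in \bar R: a capacitary
   weight is only required to be finite and nonzero outside a set of zero
   content. *)

(* A cube is given by its lower corner a and its edge length l; it is a
   genuine cube when 0 < l. *)
Definition cube (R : realType) (n : nat) (a : 'rV[R]_n) (l : R) :
    set 'rV[R]_n :=
  [set x | forall i : 'I_n, (a 0 i < x 0 i <= a 0 i + l)%R].

(* The index set I ranges over all subsets of nat, so that both finite and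
   countable coverings are allowed. *)
Definition hcontent (R : realType) (n : nat) (delta : R)
    (E : set 'rV[R]_n) : \bar R :=
  ereal_inf [set s | exists (I : set nat) (a : nat -> 'rV[R]_n) (l : nat -> R),
    [/\ (forall i, I i -> (0 < l i)%R),
        E `<=` \bigcup_(i in I) cube (a i) (l i) &
        s = \esum_(i in I) (l i `^ delta)%:E]].

Definition choquet (R : realType) (T : Type) (C : set T -> \bar R)
    (E : set T) (g : T -> \bar R) : \bar R :=
  \int[lebesgue_measure]_(t in `]0%R, +oo[%classic)
    C [set x | E x /\ t%:E < g x].

Definition hcontent_ae (R : realType) (n : nat) (delta : R)
    (P : 'rV[R]_n -> Prop) : Prop :=
  hcontent delta [set x | ~ P x] = 0.

Definition weighted_content (R : realType) (n : nat) (delta : R)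
    (w : 'rV[R]_n -> \bar R) (F : set 'rV[R]_n) : \bar R :=
  choquet (hcontent delta) F w.

Definition cube_average (R : realType) (n : nat) (delta : R)
    (a : 'rV[R]_n) (l : R) (g : 'rV[R]_n -> \bar R) : \bar R :=
  (hcontent delta (cube a l))^-1 * choquet (hcontent delta) (cube a l) g.

Definition maximal (R : realType) (n : nat) (delta : R)
    (f : 'rV[R]_n -> \bar R) (x : 'rV[R]_n) : \bar R :=
  ereal_sup [set s | exists (a : 'rV[R]_n) (l : R),
    [/\ (0 < l)%R, cube a l x &
        s = cube_average delta a l (fun y => `|f y|)]].

Definition capacitary_weight (R : realType) (n : nat) (delta : R)
    (w : 'rV[R]_n -> \bar R) : Prop :=
  [/\ forall x, 0 <= w x,
      forall E : set 'rV[R]_n, compact E ->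
        choquet (hcontent delta) E w < +oo &
      hcontent_ae delta (fun x => 0 < w x < +oo)].

(* The power w^(-1/(p-1)) is written as the inverse of w^(1/(p-1)), because
   poweR with a negative exponent sends 0 to 0 and +oo to +oo, whereas the
   extended inverse exchanges 0 and +oo. *)
Definition muckenhoupt_const_gt1 (R : realType) (n : nat) (delta p : R)
    (w : 'rV[R]_n -> \bar R) : \bar R :=
  ereal_sup [set s | exists (a : 'rV[R]_n) (l : R), (0 < l)%R /\
    s = cube_average delta a l w *
        cube_average delta a l (fun x => (w x `^ (p - 1)^-1)^-1) `^ (p - 1)].

Definition muckenhoupt_const_1 (R : realType) (n : nat) (delta : R)
    (w : 'rV[R]_n -> \bar R) : \bar R :=
  ereal_inf [set K%:E | K in [set K : R | (0 < K)%R /\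
    hcontent_ae delta (fun x => maximal delta w x <= K%:E * w x)]].

Definition muckenhoupt_const (R : realType) (n : nat) (delta p : R)
    (w : 'rV[R]_n -> \bar R) : \bar R :=
  if p == 1%R then muckenhoupt_const_1 delta w
  else muckenhoupt_const_gt1 delta p w.

Definition muckenhoupt (R : realType) (n : nat) (delta p : R)
    (w : 'rV[R]_n -> \bar R) : Prop :=
  capacitary_weight delta w /\ muckenhoupt_const delta p w < +oo.

Definition weighted_L1 (R : realType) (n : nat) (delta : R)
    (w f : 'rV[R]_n -> \bar R) : Prop :=
  choquet (hcontent delta) setT (fun x => `|f x| * w x) < +oo.

(* Main.v *)
Require Import Defs.
From HB Require Import structures.
From mathcomp Require Import all_boot all_order all_algebra.
From mathcomp Require Import all_classical all_reals all_analysis.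
From mathcomp Require Import measurable_realfun zify ring lra.
Set Implicit Arguments.
Unset Strict Implicit.
Unset Printing Implicit Defensive.
Import Order.TTheory GRing.Theory Num.Theory.
Import numFieldNormedType.Exports.
Local Open Scope classical_set_scope.
Local Open Scope ring_scope.
Local Open Scope ereal_scope.

(** Write g = |f| w, H for the Hausdorff content and W for the weighted
    content.  Both H and W are monotone and countably subadditive, but not
    additive: one of the two inequalities uses subadditivity alone, the other
    one needs the Muckenhoupt condition.

    Lower bound.  On the dyadic layer where |f| lies in ]d, 2d] the product is
    at most 2d w, so that {g > t} is covered by the sets {|f| > d, w > t / 2d},
    d ranging over the powers of 2.  Integrating in t and rescaling gives the
    sum of the 2d W{|f| > d}, which is at most 4 times the integral of the
    nonincreasing function t |-> W{|f| > t}.  This holds for every capacity: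
    choquet_product_le_iterated.

    Upper bound.  Decompose instead along the layers of g.  Where g lies in
    ]d, 2d] and |f| > t, the weight satisfies w < 2d / t, hence W{|f| > t} is
    at most the sum over d of W({g > d} inter {w < 2d / t}).  The bound thus
    follows (choquet_iterated_le_product) from the reciprocal estimate

      int_0^oo W(E inter {w < c / t}) dt <= B c H(E)        (c > 0),

    which is the case f = 1 / w localised to E.  By subadditivity of W and the
    definition of H by coverings it suffices to prove it for a cube Q
    (reciprocal_integral).  Let A = W(Q) / H(Q) and let M be the Muckenhoupt
    constant.  For every p >= 1 the Muckenhoupt condition yields

      A (H(Q inter {w < tau}) / H(Q)) ^ p <= tau M,

    by Markov's inequality for the dual weight when p > 1 and because w is
    almost everywhere at least A / M on Q when p = 1 (muckenhoupt_sublevel).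
    Split the integral at t = c / A.  Before that point bound the integrand by
    W(Q), for a total of c H(Q).  After it, bound W by c / t times H, as
    w < c / t on the set in question, and use the display: the integrand is at
    most a constant times t ^ (-1 - 1/p), and the total is p M ^ (1/p) c H(Q).
    The first contribution is of the same form because M ^ (1/p) >= 1/6
    (muckenhoupt_const_lower_bound).  The outcome is
    B = (6 + p) M ^ (1/p) and K = 4 (6 + p). *)

(** * Nonincreasing functions on the positive half-line *)

Section RealLine.
Context {R : realType}.
Implicit Types (phi : R -> \bar R) (c s t : R).

(** Superlevel sets of a monotone function are intervals. *)
Lemma measurable_nonincreasing_posR phi :
  (forall s t, (0 < s)%R -> (s <= t)%R -> phi t <= phi s) ->
  measurable_fun (`]0%R, +oo[%classic : set R) phi.
Proof.
move=> phi_ni mD.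
apply: (measurability _ (ErealGenOInfty.measurableE R)) => // _ [_ [x ->] <-].
apply: is_interval_measurable => s t /=.
rewrite !in_itv/= !andbT => -[s0 xs] [t0 xt] u /andP[su ut].
have u0 : (0 < u)%R by apply: lt_le_trans su.
split; first by rewrite in_itv/= andbT.
by rewrite in_itv/= andbT (lt_le_trans xt)//; exact: phi_ni.
Qed.

(** A bijection from nat to int, so that sums over all powers of 2 are ordinary
    series indexed by nat. *)
Definition nat_int (m : nat) : int :=
  if odd m then Negz m./2 else Posz m./2.

Lemma nat_int_inj : injective nat_int.
Proof.
move=> m m' mm'; rewrite -(odd_double_half m) -(odd_double_half m').
by move: mm'; rewrite /nat_int; case: (odd m); case: (odd m') => // -[->].
Qed.

Lemma nat_int_surj (k : int) : exists m, nat_int m = k.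
Proof.
case: k => k.
  by exists k.*2; rewrite /nat_int odd_double doubleK.
by exists k.*2.+1; rewrite /nat_int/= odd_double/= uphalf_double.
Qed.

Definition dyadic (m : nat) : R := (2 : R) ^ nat_int m.

Lemma dyadic_gt0 m : (0 < dyadic m)%R.
Proof. exact: exprz_gt0. Qed.

Lemma dyadic_cover (x : R) : (0 < x)%R ->
  exists m, (dyadic m < x <= 2 * dyadic m)%R.
Proof.
move=> x0.
have ln2 : (0 < ln (2 : R))%R by rewrite ln_gt0// ltr1n.
have pw (k : int) : ((2 : R) ^ k = expR (k%:~R * ln 2))%R.
  by rewrite -powR_intmul// /powR pnatr_eq0/=.
have [m mE] := nat_int_surj (Num.ceil (ln x / ln 2) - 1).
have two (k : int) : (2 * (2 : R) ^ k = 2 ^ (k + 1))%R.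
  by rewrite expfzDr ?pnatr_eq0// expr1z mulrC.
exists m; rewrite /dyadic mE two subrK !pw.
have := ceil_itv (ln x / ln 2).
rewrite ltr_pdivlMr// ler_pdivrMr// => /andP[h1 h2].
by rewrite -[x in (_ < x <= _)%R]lnK// ltr_expR ler_expR h1 h2.
Qed.

Lemma dyadic_trivIset :
  trivIset setT (fun m => `](dyadic m / 2)%R, dyadic m]%classic).
Proof.
have key (k k' : int) (t : R) : (2 ^ k / 2 < t <= 2 ^ k)%R ->
    (2 ^ k' / 2 < t <= 2 ^ k')%R -> (k' <= k)%R.
  move=> /andP[_ tk] /andP[k't _]; rewrite leNgt; apply/negP => kk'.
  have : ((2:R) ^ k < 2 ^ k)%R.
    apply: le_lt_trans (lt_le_trans k't tk).
    rewrite ler_pdivlMr// -[leLHS](expfzDr k 1) ?pnatr_eq0//.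
    by rewrite ler_eXz2l ?ltr1n//; lia.
  by rewrite ltxx.
move=> m m' _ _ [t [/=]]; rewrite !in_itv/= => h h'.
by apply: nat_int_inj; apply/eqP; rewrite eq_le (key _ _ _ h h') (key _ _ _ h' h).
Qed.

Lemma nonincreasing_markov phi s : (0 < s)%R ->
  (forall t, 0 <= phi t) ->
  (forall s t, (0 < s)%R -> (s <= t)%R -> phi t <= phi s) ->
  s%:E * phi s <= \int[lebesgue_measure]_(t in `]0%R, +oo[) phi t.
Proof.
move=> s0 phi0 phi_ni; have mphi := measurable_nonincreasing_posR phi_ni.
have sub : (`]0%R, s] : set R) `<=` `]0%R, +oo[.
  by move=> t /=; rewrite !in_itv/= => /andP[->].
apply: (@le_trans _ _ (\int[lebesgue_measure]_(t in `]0%R, s]) phi t)).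
  apply: (@le_trans _ _ (\int[lebesgue_measure]_(t in `]0%R, s]) (cst (phi s) t))).
    rewrite integral_cst//= muleC; apply: lee_pmul => //; rewrite ?lee_fin ?(ltW s0)//.
    by rewrite lebesgue_measure_itv/= lte_fin s0 oppr0 adde0.
  apply: ge0_le_integral => //.
  - by move=> t _; exact: phi0.
  - exact: (measurable_funS _ sub mphi).
  - by move=> t /=; rewrite in_itv/= => /andP[t0 ts]; exact: phi_ni.
by apply: ge0_subset_integral.
Qed.

(** The value d phi(d) is twice the area of a rectangle of base ]d/2, d] lying
    under the graph of phi, and these bases are pairwise disjoint. *)
Lemma dyadic_sum_le_integral phi :
  (forall t, 0 <= phi t) ->
  (forall s t, (0 < s)%R -> (s <= t)%R -> phi t <= phi s) ->
  \sum_(0 <= m <oo) (dyadic m)%:E * phi (dyadic m) <=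
  2%:E * \int[lebesgue_measure]_(t in `]0%R, +oo[) phi t.
Proof.
move=> phi0 phi_ni; have mphi := measurable_nonincreasing_posR phi_ni.
pose J m : set R := `](dyadic m / 2)%R, dyadic m]%classic.
have mJ m : measurable (J m) by exact: measurable_itv.
have J0 : \bigcup_m J m `<=` `]0%R, +oo[.
  move=> t [m _] /=; rewrite !in_itv/= => /andP[+ _]; rewrite andbT.
  by apply: lt_trans; rewrite divr_gt0// dyadic_gt0.
have mJJ : measurable (\bigcup_m J m) by exact: bigcup_measurable.
apply: (@le_trans _ _
    (2%:E * \int[lebesgue_measure]_(t in \bigcup_m J m) phi t)); last first.
  by rewrite lee_pmul2l// ge0_subset_integral.
rewrite (ge0_integral_bigcup lebesgue_measure mJ (measurable_funS _ J0 mphi))//;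
  last exact: dyadic_trivIset.
rewrite -nneseriesZl; last by move=> m _; exact: integral_ge0.
apply: lee_nneseries => m;
  first by move=> _ _; rewrite mule_ge0// lee_fin ltW ?dyadic_gt0.
move=> _; have d0 := dyadic_gt0 m.
apply: (@le_trans _ _
    (2%:E * \int[lebesgue_measure]_(t in J m) cst (phi (dyadic m)) t)).
  rewrite /J integral_cst//= [leRHS]muleCA [leLHS]muleC; apply: lee_pmul => //.
    by rewrite lee_fin ltW.
  rewrite lebesgue_measure_itv/= lte_fin ifT.
    by rewrite -EFinB -EFinM lee_fin; lra.
  lra.
rewrite lee_pmul2l//. apply: ge0_le_integral => //.
- exact: mJ.
- by move=> t _; exact: phi0.
- apply: (measurable_funS _ _ mphi) => //= t Jt; apply: J0; by exists m.
- move=> t; rewrite /J/= in_itv/= => /andP[t0 ts]; apply: phi_ni => //; lra.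
Qed.

(** The image of the Lebesgue measure under t |-> t / c is c times the Lebesgue
    measure, as can be seen on intervals. *)
Lemma integral_posR_scale phi c : (0 < c)%R ->
  (forall t, 0 <= phi t) ->
  (forall s t, (0 < s)%R -> (s <= t)%R -> phi t <= phi s) ->
  \int[lebesgue_measure]_(t in `]0%R, +oo[) phi (t / c)%R =
  c%:E * \int[lebesgue_measure]_(t in `]0%R, +oo[) phi t.
Proof.
move=> c0 phi0 phi_ni; have mphi := measurable_nonincreasing_posR phi_ni.
pose f : measurableTypeR R -> measurableTypeR R := fun t : R => (t / c)%R.
have mf : measurable_fun setT f by exact: mulrr_measurable.
pose mu := lebesgue_measure : {measure set (measurableTypeR R) -> \bar R}.
pose nu := measure_function_pushforward__canonical__measure_function_Measure mu mf.
have cV : (0 <= c^-1)%R by rewrite invr_ge0 ltW.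
have scaleE A : measurable A -> mu A = mscale (NngNum cV) nu A.
  apply: lebesgue_measure_unique => _ [[a b] _ <-] /=.
  rewrite /mscale/= /pushforward/= (_ : f @^-1` _ = `](a * c)%R, (b * c)%R]%classic).
    rewrite /mu !lebesgue_measure_itv/= !lte_fin ltr_pM2r//.
    case: ifP => ab; last by rewrite mule0.
    by rewrite -!EFinB -EFinM -mulrBl; congr _%:E; field; rewrite gt_eqF.
  apply/seteqP; split => t /=; rewrite !in_itv/= /f;
    by rewrite ltr_pdivlMr// ler_pdivrMr.
rewrite [in RHS](eq_measure_integral (mscale (NngNum cV) nu));
  last by move=> A mA _; exact: scaleE.
rewrite ge0_integral_mscale//= muleA -EFinM divff ?gt_eqF// mul1e.
rewrite (ge0_integral_pushforward mf)//.
rewrite (_ : f @^-1` _ = `]0%R, +oo[%classic)//.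
by apply/seteqP; split => t /=; rewrite !in_itv/= /f !andbT ?pmulr_lgt0 ?invr_gt0.
Qed.

End RealLine.

Lemma cvg_powRN (R : realType) (q : R) : (0 < q)%R ->
  (x `^ (- q))%R @[x --> +oo%R] --> (0%R : R).
Proof.
move=> q0; apply/cvgrPdist_le => e e0; near=> x.
have x0 : (0 < x)%R by near: x; exact: nbhs_pinfty_gt.
have x0' : (0 <= x)%R by exact: ltW.
rewrite sub0r normrN ger0_norm ?powR_ge0// powRN.
rewrite -[leRHS]invrK lef_pV2 ?posrE ?powR_gt0 ?invr_gt0//.
have xe : (e^-1 `^ q^-1 <= x)%R by near: x; exact: nbhs_pinfty_ge.
have q1 : (q^-1 * q = 1)%R by rewrite mulVf// gt_eqF.
rewrite -[leLHS]powRr1 ?invr_ge0 ?(ltW e0)// -q1 powRrM.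
apply: ge0_ler_powR; rewrite ?nnegrE ?powR_ge0 ?(ltW q0) //.
Unshelve. all: by end_near. Qed.

Lemma integral_powR_tail (R : realType) (a q : R) : (0 < a)%R -> (0 < q)%R ->
  \int[lebesgue_measure]_(t in `[a, +oo[) (t `^ (- q - 1))%R%:E =
  (a `^ (- q) / q)%R%:E.
Proof.
move=> a0 q0.
pose F (x : R) := (- (q^-1 * x `^ (- q)))%R.
have dF (x : R) : (0 < x)%R -> is_derive x 1%R F (x `^ (- q - 1))%R.
  move=> x0; have := is_derive1_powR (- q) x0 => dp.
  apply: is_derive_eq.
  rewrite /GRing.scale/= mulNr mulrN opprK mulrA mulVf ?gt_eqF// mul1r.
  by [].
have cF (x : R) : (0 < x)%R -> {for x, continuous F}.
  move=> x0; apply: differentiable_continuous; apply/derivable1_diffP.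
  by have [] := dF x x0.
have cf (x : R) : (0 < x)%R -> {for x, continuous (fun t : R => t `^ (- q - 1))%R}.
  move=> x0; apply: differentiable_continuous; apply/derivable1_diffP.
  by have [] := is_derive1_powR (- q - 1) x0.
(* F is a primitive of the integrand that vanishes at infinity *)
rewrite (@ge0_continuous_FTC2y _ _ F a 0).
- by rewrite -EFinB sub0r /F opprK mulrC.
- by move=> x _; exact: powR_ge0.
- apply: continuous_in_subspaceT => x; rewrite inE/= in_itv/= andbT => ax.
  by apply: cf; exact: lt_le_trans ax.
- rewrite -oppr0 -(mulr0 (q^-1)%R); apply: cvgN; apply: cvgM; first exact: cvg_cst.
  exact: cvg_powRN.
- by move=> x ax; have [] := dF x (lt_trans a0 ax).
- by apply: cvg_at_right_filter; exact: cF.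
- move=> x; rewrite in_itv/= andbT => ax.
  by rewrite derive1E; apply: derive_val; exact: dF (lt_trans a0 ax).
Qed.

Section IntegralMonotone.
Context {R : realType}.
Implicit Types (phi psi : R -> \bar R).

Lemma le_integral_nonincreasing phi psi :
  (forall t, 0 <= phi t) ->
  (forall s t, (0 < s)%R -> (s <= t)%R -> phi t <= phi s) ->
  (forall s t, (0 < s)%R -> (s <= t)%R -> psi t <= psi s) ->
  (forall t, (0 < t)%R -> phi t <= psi t) ->
  \int[lebesgue_measure]_(t in `]0%R, +oo[) phi t <=
  \int[lebesgue_measure]_(t in `]0%R, +oo[) psi t.
Proof.
move=> phi0 phi_ni psi_ni le; apply: ge0_le_integral => //.
- exact: (measurable_nonincreasing_posR phi_ni).
- exact: (measurable_nonincreasing_posR psi_ni).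
- by move=> t /=; rewrite in_itv/= andbT => t0; exact: le.
Qed.

Lemma le_integral_nneseries phi (psi : nat -> R -> \bar R) :
  (forall t, 0 <= phi t) ->
  (forall s t, (0 < s)%R -> (s <= t)%R -> phi t <= phi s) ->
  (forall m t, 0 <= psi m t) ->
  (forall m s t, (0 < s)%R -> (s <= t)%R -> psi m t <= psi m s) ->
  (forall t, (0 < t)%R -> phi t <= \sum_(0 <= m <oo) psi m t) ->
  \int[lebesgue_measure]_(t in `]0%R, +oo[) phi t <=
  \sum_(0 <= m <oo) \int[lebesgue_measure]_(t in `]0%R, +oo[) psi m t.
Proof.
move=> phi0 phi_ni psi0 psi_ni le.
rewrite -integral_nneseries//; last first.
  by move=> m; exact: (measurable_nonincreasing_posR (psi_ni m)).
apply: le_integral_nonincreasing => // s t s0 st.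
by apply: lee_nneseries => // m _; exact: psi_ni.
Qed.

Lemma integral_posR_split phi (c : R) : (0 < c)%R ->
  (forall t, 0 <= phi t) ->
  (forall s t, (0 < s)%R -> (s <= t)%R -> phi t <= phi s) ->
  \int[lebesgue_measure]_(t in `]0%R, +oo[) phi t =
  \int[lebesgue_measure]_(t in `]0%R, c]) phi t +
  \int[lebesgue_measure]_(t in `]c, +oo[) phi t.
Proof.
move=> c0 phi0 phi_ni.
have E : `]0%R, +oo[%classic = `]0%R, c]%classic `|` `]c, +oo[%classic.
  by rewrite -itv_bndbnd_setU// bnd_simp ltW.
rewrite E ge0_integral_setU// -?E.
  exact: (measurable_nonincreasing_posR phi_ni).
apply/disj_setPRL => t /=; rewrite !in_itv/= => /andP[ct _] /andP[_ tc].
by move: ct; rewrite ltNge tc.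
Qed.

Lemma integral_itv0_le phi (c : R) (v : \bar R) : (0 < c)%R ->
  (forall t, 0 <= phi t) ->
  (forall s t, (0 < s)%R -> (s <= t)%R -> phi t <= phi s) ->
  (forall t, (0 < t)%R -> (t <= c)%R -> phi t <= v) ->
  \int[lebesgue_measure]_(t in `]0%R, c]) phi t <= c%:E * v.
Proof.
move=> c0 phi0 phi_ni phiv.
apply: (@le_trans _ _ (\int[lebesgue_measure]_(t in `]0%R, c]) cst v t)).
  apply: ge0_le_integral => //.
  - have sub : `]0%R, c]%classic `<=` `]0%R, +oo[%classic.
      by move=> t /=; rewrite !in_itv/= => /andP[->].
    exact: (measurable_funS _ sub (measurable_nonincreasing_posR phi_ni)).
  - by move=> t /=; rewrite in_itv/= => /andP[t0 tc]; exact: phiv.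
by rewrite integral_cst//= lebesgue_measure_itv/= lte_fin c0 oppr0 adde0 muleC.
Qed.
End IntegralMonotone.

(** * Capacities and their Choquet integrals *)

Record capacity {R : realType} {T : Type} (C : set T -> \bar R) : Prop :=
  Capacity {
    cap_ge0 : forall E, 0 <= C E;
    cap_le : forall E F, E `<=` F -> C E <= C F;
    cap_set0 : C set0 = 0;
    cap_bigcup : forall F : nat -> set T,
      C (\bigcup_m F m) <= \sum_(0 <= m <oo) C (F m) }.

Section Choquet.
Context {R : realType} {T : Type} (C : set T -> \bar R).
Hypothesis capC : capacity C.
Implicit Types (A B E F N : set T) (g : T -> \bar R).

Lemma cap_setU A B : C (A `|` B) <= C A + C B.
Proof.
rewrite -bigcup2E; apply: le_trans (cap_bigcup capC _) _.
rewrite (nneseries_split 0 2)//; last by move=> k _; exact: cap_ge0.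
rewrite add0n big_mkord !big_ord_recl big_ord0 adde0/= eseries0 ?adde0//.
by move=> [|[|k]] //= _ _; rewrite (cap_set0 capC).
Qed.

Lemma cap_cover E N (F : nat -> set T) : C N = 0 ->
  E `<=` N `|` \bigcup_m F m -> C E <= \sum_(0 <= m <oo) C (F m).
Proof.
move=> N0 /(cap_le capC) /le_trans; apply; apply: le_trans (cap_setU _ _) _.
by rewrite N0 add0e; exact: cap_bigcup.
Qed.

Lemma cap_level_le E F g h s t : E `<=` F -> (forall x, E x -> g x <= h x) ->
  (s <= t)%R ->
  C [set x | E x /\ t%:E < g x] <= C [set x | F x /\ s%:E < h x].
Proof.
move=> EF gh st; apply: cap_le => // x /= [Ex tg]; split; first exact: EF.
by apply: lt_le_trans (gh _ Ex); apply: le_lt_trans tg; rewrite lee_fin.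
Qed.

Let level_ni E g s t : (0 < s)%R -> (s <= t)%R ->
  C [set x | E x /\ t%:E < g x] <= C [set x | E x /\ s%:E < g x].
Proof. by move=> _; exact: cap_level_le. Qed.

Let level_ge0 E g t : 0 <= C [set x | E x /\ t%:E < g x].
Proof. exact: cap_ge0. Qed.

Lemma choquet_ge0 E g : 0 <= choquet C E g.
Proof. by apply: integral_ge0 => t _; exact: cap_ge0. Qed.

Lemma le_choquet E F g h : E `<=` F -> (forall x, E x -> g x <= h x) ->
  choquet C E g <= choquet C F h.
Proof.
move=> EF gh; apply: le_integral_nonincreasing => //.
- exact: level_ni.
- exact: level_ni.
- by move=> t t0; exact: cap_level_le.
Qed.

Lemma choquet_markov E g s : (0 < s)%R ->
  s%:E * C [set x | E x /\ s%:E < g x] <= choquet C E g.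
Proof.
move=> s0.
apply: (nonincreasing_markov (phi := fun t => C [set x | E x /\ t%:E < g x])) => //.
exact: level_ni.
Qed.

(** Integrating a fixed function over varying sets gives a capacity again, so that
    the lemmas on capacities apply to weighted contents as well. *)
Lemma choquet_capacity g : capacity (fun E => choquet C E g).
Proof.
split.
- by move=> E; exact: choquet_ge0.
- by move=> E F EF; exact: le_choquet.
- rewrite /choquet; apply: integral0_eq => t _.
  by rewrite [X in C X](_ : _ = set0) ?(cap_set0 capC)//; apply/seteqP; split => x // [].
- move=> F; apply: le_integral_nneseries => //; [exact: level_ni| |].
    by move=> m; exact: level_ni.
  move=> t t0; apply: (cap_cover (N := set0)); first exact: cap_set0.
  by move=> x [[m _ Fx] tx]; right; exists m.
Qed.

Lemma choquet0_null E g : choquet C E g = 0 -> C [set x | E x /\ 0 < g x] = 0.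
Proof.
move=> g0; apply/eqP; rewrite eq_le cap_ge0// andbT.
have lev0 (m : nat) : C [set x | E x /\ (m.+1%:R^-1)%:E < g x] = 0.
  apply/eqP; rewrite eq_le cap_ge0// andbT.
  have m0 : (0 < m.+1%:R^-1 :> R)%R by rewrite invr_gt0.
  have := choquet_markov E g m0; rewrite g0.
  by rewrite -[X in _ <= X -> _](mule0 (m.+1%:R^-1)%:E) lee_pmul2l// lte_fin.
pose L (m : nat) := [set x | E x /\ (m.+1%:R^-1)%:E < g x].
apply: le_trans (cap_cover (N := set0) (F := L) _ _) _.
- exact: cap_set0.
- move=> x [Ex gx]; right.
  suff [m mg] : exists m : nat, (m.+1%:R^-1)%:E < g x by exists m.
  case: (g x) gx => [r| |]//; last by exists 0%N; rewrite ltry.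
  rewrite lte_fin => r0; have [m] := ltr_add_invr r0.
  by rewrite add0r => mr; exists m; rewrite lte_fin.
- by rewrite eseries0// => m _ _; exact: lev0.
Qed.

Lemma choquet_lty_null E g : choquet C E g < +oo ->
  C [set x | E x /\ g x = +oo] = 0.
Proof.
move=> goo; set N := (X in C X).
have key s : (0 < s)%R -> s%:E * C N <= choquet C E g.
  move=> s0; apply: le_trans (choquet_markov E g s0).
  rewrite lee_pmul2l// ?lte_fin//; apply: cap_le => // x /= [Ex ->].
  by rewrite ltry.
have := choquet_ge0 E g; have := cap_ge0 capC N.
case: (choquet C E g) goo key => // I _ key; case: (C N) key => // [c|] key.
- rewrite !lee_fin le_eqVlt => /predU1P[<- //|c0 I0].
  have := key ((I + 1) / c)%R; rewrite divr_gt0 ?ltr_wpDl//.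
  by rewrite -EFinM lee_fin divfK ?gt_eqF// gerDl ler10 => /(_ isT).
(* c = +oo : already s = 1 contradicts the finiteness of the integral *)
- by have := key 1%R; rewrite ltr01 mul1e leye_eq => /(_ isT).
Qed.

Lemma choquet_le_cst E g c : (0 < c)%R -> (forall x, E x -> g x <= c%:E) ->
  choquet C E g <= c%:E * C E.
Proof.
move=> c0 gc; rewrite /choquet.
rewrite (integral_posR_split c0 (level_ge0 E g) (level_ni E g)).
rewrite [X in _ + X]integral0_eq ?adde0; last first.
  move=> t /=; rewrite in_itv/= andbT => ct.
  rewrite [X in C X](_ : _ = set0) ?(cap_set0 capC)//.
  apply/seteqP; split => // x [/gc gx tg].
  by have := lt_le_trans tg gx; rewrite lte_fin ltNge ltW.
apply: integral_itv0_le => //; first exact: level_ni.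
by move=> t _ _; apply: cap_le => // x [].
Qed.
End Choquet.

Lemma choquet_null_set (R : realType) (T : Type) (C : set T -> \bar R) N g :
  capacity C -> C N = 0 -> choquet C N g = 0.
Proof.
move=> capC N0; apply: integral0_eq => t _; apply/eqP.
rewrite eq_le cap_ge0// andbT -N0; by apply: cap_le => // x [].

Qed.

(** * Comparing the integral of a product with the iterated integral *)

Section ProductAndIterated.
Context {R : realType} {T : Type} (C : set T -> \bar R).
Hypothesis capC : capacity C.
Variables (w f : T -> \bar R).
Hypotheses (w0 : forall x, 0 <= w x) (f0 : forall x, 0 <= f x).

Let W E := choquet C E w.
Let g x := f x * w x.

Let capW : capacity W. Proof. exact: choquet_capacity. Qed.

(** Layers of f: where f lies in ]d, 2d], f w > t forces w > t / 2d. *)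
Lemma choquet_product_le_iterated :
  choquet C setT g <= 4%:E * choquet W setT f.
Proof.
have [foo|] := ltP (choquet W setT f) +oo; last first.
  by rewrite leye_eq => /eqP ->; rewrite gt0_muley// leey.
have W_level_ni s t : (0 < s)%R -> (s <= t)%R ->
    W [set x | setT x /\ t%:E < f x] <= W [set x | setT x /\ s%:E < f x].
  by move=> _; exact: cap_level_le.
(* points where f is infinite escape the dyadic layers; finiteness of the
   right-hand side makes them negligible *)
pose N := [set x | (setT x /\ f x = +oo) /\ 0 < w x].
have N0 : C N = 0 by apply: choquet0_null => //; exact: choquet_lty_null foo.
pose L m := [set x | setT x /\ (dyadic m : R)%:E < f x].
pose psi m s := C [set x | L m x /\ s%:E < w x].
have psi_ni m s t : (0 < s)%R -> (s <= t)%R -> psi m t <= psi m s.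
  by move=> _; exact: cap_level_le.
have c0 m : (0 < 2 * dyadic m :> R)%R by rewrite mulr_gt0// dyadic_gt0.
have step1 : choquet C setT g <=
    \sum_(0 <= m <oo) \int[lebesgue_measure]_(t in `]0%R, +oo[)
       psi m (t / (2 * dyadic m))%R.
  apply: (le_integral_nneseries
    (psi := fun m t => psi m (t / (2 * dyadic m))%R)).
  - by move=> t; exact: cap_ge0.
  - by move=> s t _; exact: cap_level_le.
  - by move=> m t; exact: cap_ge0.
  - move=> m s t s0 st; apply: psi_ni; first by rewrite divr_gt0.
    by rewrite ler_pM2r ?invr_gt0.
  move=> t t0; apply: (cap_cover capC N0) => x [_].
  rewrite /g => tfw.
  have wx : 0 < w x.
    rewrite lt_neqAle w0 andbT; apply/eqP => wx; move: tfw.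
    by rewrite -wx mule0 lte_fin ltNge ltW.
  case fx : (f x) (f0 x) tfw => [r| |]//; last by move=> _ _; left.
  rewrite lee_fin => r0 tfw; right.
  have {}r0 : (0 < r)%R.
    rewrite lt_neqAle r0 andbT; apply/eqP => r00; move: tfw.
    by rewrite -r00 mul0e lte_fin ltNge ltW.
  have [m /andP[dr rd]] := dyadic_cover r0.
  exists m => //; split; first by split => //; rewrite fx lte_fin.
  rewrite EFinM muleC lte_pdivrMl//; apply: lt_le_trans tfw _.
  by apply: lee_wpmul2r => //; rewrite lee_fin.
apply: (le_trans step1).
apply: (@le_trans _ _ (\sum_(0 <= m <oo) 2%:E * ((dyadic m)%:E * W (L m)))).
  apply: lee_nneseries => m.
    by move=> _ _; apply: integral_ge0 => t _; exact: cap_ge0.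
  move=> _; rewrite integral_posR_scale//; last 2 first.
  - by move=> t; exact: cap_ge0.
  - exact: psi_ni.
  by rewrite muleA -EFinM.
rewrite nneseriesZl; last first.
  by move=> m _; rewrite mule_ge0 ?cap_ge0// lee_fin ltW// dyadic_gt0.
rewrite (_ : 4%:E = 2%:E * 2%:E); last by rewrite -EFinM; congr _%:E; ring.
rewrite -muleA lee_pmul2l//.
apply: (dyadic_sum_le_integral
  (phi := fun t => W [set x | setT x /\ t%:E < f x])) => //.
by move=> t; exact: cap_ge0.
Qed.

(** Layers of f w: where f w lies in ]d, 2d], f > t forces w < 2d / t, so only
    the case f = 1 / w of the inequality, on arbitrary sets of finite capacity,
    has to be supplied. *)
Lemma choquet_iterated_le_product (B : R) : (0 <= B)%R ->
  C [set x | ~ (0 < w x < +oo)] = 0 ->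
  (forall E c, (0 < c)%R -> C E < +oo ->
    \int[lebesgue_measure]_(t in `]0%R, +oo[)
      W [set x | E x /\ w x < (c / t)%:E] <= (B * c)%:E * C E) ->
  choquet C setT g < +oo ->
  choquet W setT f <= (4 * B)%:E * choquet C setT g.
Proof.
move=> B0 w_ae recip goo.
pose N := [set x | ~ (0 < w x < +oo)] `|` [set x | setT x /\ g x = +oo].
have N0 : W N = 0.
  apply: choquet_null_set => //; apply/eqP; rewrite eq_le cap_ge0// andbT.
  apply: le_trans (cap_setU capC _ _) _.
  by rewrite w_ae (choquet_lty_null capC goo) adde0.
pose L m := [set x | setT x /\ (dyadic m : R)%:E < g x].
pose F m t := [set x | L m x /\ w x < (2 * dyadic m / t)%:E].
have c0 m : (0 < 2 * dyadic m :> R)%R by rewrite mulr_gt0// dyadic_gt0.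
have step1 : choquet W setT f <=
    \sum_(0 <= m <oo) \int[lebesgue_measure]_(t in `]0%R, +oo[) W (F m t).
  apply: (le_integral_nneseries (psi := fun m t => W (F m t))).
  - by move=> t; exact: cap_ge0.
  - by move=> s t _; exact: cap_level_le.
  - by move=> m t; exact: cap_ge0.
  - move=> m s t s0 st; apply: cap_le => // x [Lx wx]; split => //.
    apply: lt_le_trans wx _; rewrite lee_fin ler_pM2l// lef_pV2// posrE.
    exact: lt_le_trans st.
  move=> t t0; apply: (cap_cover capW N0) => x [_ tf].
  have [wx|] := pselect (0 < w x < +oo); last by move=> ?; left; left.
  have [gx|gx] := eqVneq (g x) +oo; first by left; right.
  have /andP[wx0 wxoo] := wx.
  right; move: wx0 wxoo gx; rewrite /F /L /g.
  case wE : (w x) (w0 x) => [v| |]// _; rewrite lte_fin => v0 _.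
  case fE : (f x) tf (f0 x) => [r| |]//; last by rewrite gt0_mulye ?lte_fin.
  rewrite lte_fin lee_fin => tr r0 _.
  have {}r0 : (0 < r)%R by exact: lt_trans tr.
  have [m /andP[dr rd]] := dyadic_cover (mulr_gt0 r0 v0).
  exists m => //; split; first by split => //=; rewrite wE fE -EFinM lte_fin.
  rewrite /= wE lte_fin ltr_pdivlMr//; apply: lt_le_trans rd.
  by rewrite mulrC ltr_pM2r.
apply: (le_trans step1).
apply: (@le_trans _ _
    (\sum_(0 <= m <oo) (2 * B)%:E * ((dyadic m)%:E * C (L m)))).
  apply: lee_nneseries => m.
    by move=> _ _; apply: integral_ge0 => t _; exact: cap_ge0.
  move=> _; apply: le_trans (recip _ _ (c0 m) _) _.
    have d0 : (0 < dyadic m :> R)%R by exact: dyadic_gt0.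
    have := le_lt_trans (choquet_markov capC setT g d0) goo.
    rewrite -/(L m); case: (C (L m)) => // [r|]; rewrite ?ltry//.
    by rewrite gt0_muley ?lte_fin.
  by rewrite muleA -EFinM [X in X%:E * _](_ : _ = 2 * B * dyadic m)%R//; ring.
rewrite nneseriesZl; last first.
  by move=> m _; rewrite mule_ge0 ?cap_ge0// lee_fin ltW// dyadic_gt0.
rewrite (_ : (4 * B)%:E = (2 * B)%:E * 2%:E);
  last by rewrite -EFinM; congr _%:E; ring.
rewrite -muleA lee_wpmul2l// ?lee_fin ?mulr_ge0//.
apply: (dyadic_sum_le_integral
  (phi := fun t => C [set x | setT x /\ t%:E < g x])) => //.
- by move=> t; exact: cap_ge0.
- by move=> s t _; exact: cap_level_le.
Qed.
End ProductAndIterated.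

(** * The Hausdorff content is a capacity *)

Section HausdorffContent.
Context {R : realType} {n : nat} (delta : R).
Local Notation H := (@hcontent R n delta).
Implicit Types (E F : set 'rV[R]_n).

Lemma hcontent_ge0 E : 0 <= H E.
Proof.
apply/ereal_infP => _ [I [a [l [_ _ ->]]]].
by apply: esum_ge0 => i _; rewrite lee_fin powR_ge0.
Qed.

Lemma hcontent_cube a (l : R) : (0 < l)%R -> H (cube a l) <= (l `^ delta)%:E.
Proof.
move=> l0; apply: ereal_inf_lbound.
exists [set 0%N], (fun=> a), (fun=> l); split => //.
  by move=> x Qx; exists 0%N.
by rewrite esum_set1// lee_fin powR_ge0.
Qed.

(** For countable subadditivity, choose a covering of F m that is optimal up to
    e / 2 ^ (m + 1), and merge all of them along a bijection between nat and
    nat * nat. *)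
Lemma hcontent_capacity : capacity H.
Proof.
split.
- exact: hcontent_ge0.
- move=> E F EF; apply/ereal_infP => _ [I [a [l [l0 Fal ->]]]].
  by apply: ereal_inf_lbound; exists I, a, l; split => //; exact: subset_trans Fal.
- apply/eqP; rewrite eq_le hcontent_ge0 andbT; apply: ereal_inf_lbound.
  by exists set0, (fun=> 0%R), (fun=> 0%R); split => //; rewrite esum_set0.
move=> F.
have [[m Foo]|/forallNP Foo] := pselect (exists m, H (F m) = +oo).
  rewrite (eseries_pinfty _ _ Foo) ?leey// => k _.
  by rewrite -ltNye (lt_le_trans _ (hcontent_ge0 _)).
apply/lee_addgt0Pr => e e0.
apply: le_trans (epsilon_trick xpredT _ (ltW e0)); last first.
  by move=> m; exact: hcontent_ge0.
pose P m (c : set nat * (nat -> 'rV[R]_n) * (nat -> R)) :=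
  [/\ forall i, c.1.1 i -> (0 < c.2 i)%R,
      F m `<=` \bigcup_(i in c.1.1) cube (c.1.2 i) (c.2 i) &
      \esum_(i in c.1.1) (c.2 i `^ delta)%:E
        <= H (F m) + (e / (2 ^ m.+1)%:R)%:E].
have [c Pc] : {c & forall m, P m (c m)}.
  apply: (@choice _ _ P) => m.
  have Ffin : H (F m) \is a fin_num.
    by rewrite ge0_fin_numE ?hcontent_ge0// ltey; apply/eqP; exact: Foo.
  have em : (0 < e / (2 ^ m.+1)%:R)%R by rewrite divr_gt0// ltr0n expn_gt0.
  have [_ [I [a [l [l0 Fal ->]]]] /ltW] := lb_ereal_inf_adherent em Ffin.
  by move=> le; exists (I, a, l).
have /card_esym/ppcard_eqP[b] := card_nat2.
pose S : set (nat * nat) := setT `*`` (fun m => (c m).1.1).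
apply: (@le_trans _ _ (\esum_(k in S) ((c k.1).2 k.2 `^ delta)%:E)).
  apply: ereal_inf_lbound.
  exists (b @^-1` S), (fun k => (c (b k).1).1.2 (b k).2),
    (fun k => (c (b k).1).2 (b k).2); split.
  - by move=> k [_ Ik]; case: (Pc (b k).1) => + _ _; exact.
  - move=> x [m _ Fx]; case: (Pc m) => _ /(_ _ Fx) [i Ii xi] _.
    exists (b^-1%FUN (m, i)); first by rewrite /S/= invK ?inE.
    by rewrite invK ?inE.
  - apply: (reindex_esum _ _ b); split.
    + by move=> k.
    + by move=> j k _ _; apply: (inj (f := b)); rewrite inE.
    + by move=> y Sy; exists (b^-1%FUN y); rewrite /= ?invK ?inE.
rewrite -(@esum_esum _ _ _ setT (fun m => (c m).1.1)
  (fun m i => ((c m).2 i `^ delta)%:E)); last first.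
  by move=> m i _ _; rewrite lee_fin powR_ge0.
rewrite -nneseries_esumT; last first.
  by move=> m; apply: esum_ge0 => i _; rewrite lee_fin powR_ge0.
apply: lee_nneseries => m; last by case: (Pc m).
by move=> _ _; apply: esum_ge0 => i _; rewrite lee_fin powR_ge0.
Qed.
End HausdorffContent.

(** * Consequences of the Muckenhoupt condition *)

Section CubeEstimates.
Context {R : realType} {n : nat} (delta p : R) (w : 'rV[R]_n -> \bar R).
Hypothesis p1 : (1 <= p)%R.
Hypothesis capw : capacitary_weight delta w.
Local Notation H := (@hcontent R n delta).
Local Notation W := (weighted_content delta w).
Implicit Types (E : set 'rV[R]_n) (a : 'rV[R]_n) (l h v M : R).

Let capH : capacity H. Proof. exact: hcontent_capacity. Qed.
Let capW : capacity W. Proof. exact: choquet_capacity. Qed.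
Let w0 x : 0 <= w x. Proof. by case: capw. Qed.

Lemma cube_average_ge0 a l g : 0 <= cube_average delta a l g.
Proof. by rewrite /cube_average mule_ge0 ?inve_ge0 ?cap_ge0// choquet_ge0. Qed.

Lemma muckenhoupt_const_ge0 : 0 <= muckenhoupt_const delta p w.
Proof.
rewrite /muckenhoupt_const; case: ifP => _.
  by apply/ereal_infP => _ [K [K0 _] <-]; rewrite lee_fin ltW.
apply: ereal_sup_ge.
exists (cube_average delta 0%R 1%R w *
  cube_average delta 0%R 1%R (fun x => (w x `^ (p - 1)^-1)^-1) `^ (p - 1)).
  by exists 0%R, 1%R; split.
by rewrite mule_ge0 ?poweR_ge0// cube_average_ge0.
Qed.

Lemma weighted_content_cube_lty a l : W (cube a l) < +oo.
Proof.
have [_ wloc _] := capw.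
pose K := [set x : 'rV[R]_n | forall i, `[a 0 i, a 0 i + l]%classic (x 0 i)]%R.
have cK : compact K.
  apply: (@rV_compact R n (fun i => `[a 0 i, a 0 i + l]%classic)%R) => i.
  exact: segment_compact.
apply: le_lt_trans (wloc _ cK); apply: le_choquet => // x Qx i /=.
by rewrite in_itv/=; have /andP[/ltW -> ->] := Qx i.
Qed.

Lemma hcontent_cube_lty a l : (0 < l)%R -> H (cube a l) < +oo.
Proof. by move=> l0; apply: le_lt_trans (hcontent_cube _ a l0) (ltry _). Qed.

Lemma weighted_content_le_cst E c : (0 < c)%R -> (forall x, E x -> w x <= c%:E) ->
  W E <= c%:E * H E.
Proof. exact: choquet_le_cst. Qed.

(** The single form in which the Muckenhoupt condition is used, common to all
    p >= 1: with A = v / h the average of w over the cube, the sublevel set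
    {w < tau} fills at most a fraction (tau M / A) ^ (1/p) of the cube. *)
Lemma muckenhoupt_sublevel a l h v M tau y : (0 < l)%R ->
  muckenhoupt_const delta p w = M%:E ->
  H (cube a l) = h%:E -> (0 < h)%R ->
  W (cube a l) = v%:E -> (0 < v)%R ->
  (0 < tau)%R ->
  H [set x | cube a l x /\ w x < tau%:E] = y%:E ->
  (v / h * (y / h) `^ p <= tau * M)%R.
Proof.
move=> l0 ME hE h0 vE v0 tau0 yE.
have y0 : (0 <= y)%R by rewrite -lee_fin -yE cap_ge0.
have yh : (y <= h)%R.
  by rewrite -lee_fin -yE -hE; apply: cap_le => // x [].
have r0 : (0 <= y / h)%R by rewrite divr_ge0// ltW.
have r1 : (y / h <= 1)%R by rewrite ler_pdivrMr// mul1r.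
have avgE : cube_average delta a l w = (v / h)%:E.
  by rewrite /cube_average -/(W _) vE hE inver gt_eqF// -EFinM mulrC.
move: ME; rewrite /muckenhoupt_const; case: ifPn => [/eqP pE|pn1] ME.
- rewrite pE powRr1//.
  suff : (v / h * (y / h) / tau)%:E <= M%:E.
    by rewrite lee_fin ler_pdivrMr// mulrC (mulrC tau).
  rewrite -ME; apply/ereal_infP => _ [K [K0 Kae] <-]; rewrite /hcontent_ae in Kae.
  rewrite lee_fin ler_pdivrMr//.
  (* a sublevel set of positive content contains a point x where the maximal
     function, hence the average v / h, is at most K w(x) < K tau *)
  have [y00|yn0] := eqVneq y 0%R.
    by rewrite y00 mul0r mulr0 mulr_ge0 // ltW.
  have [x [[Qx wx] Mx]] : exists x, (cube a l x /\ w x < tau%:E) /\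
      maximal delta w x <= K%:E * w x.
    apply: contrapT => /forallNP none; move/eqP: yn0; apply.
    apply/eqP; rewrite eq_le y0 andbT -lee_fin -yE.
    apply: le_trans (_ : H [set x | ~ maximal delta w x <= K%:E * w x] <= _).
      by apply: cap_le => // x Qx Mx; exact: (none x).
    by rewrite [leLHS]Kae.
  have vhK : (v / h <= K * tau)%R.
    rewrite -lee_fin; apply: (@le_trans _ _ (maximal delta w x)).
      apply: ereal_sup_ubound; exists a, l; split => //.
      rewrite -avgE; congr cube_average; apply/funext => z.
      by rewrite gee0_abs.
    apply: le_trans Mx _; rewrite EFinM lee_pmul2l// ?lte_fin//.
    exact: ltW.
  apply: le_trans vhK; rewrite -[leRHS]mulr1; apply: ler_wpM2l => //.
  by rewrite divr_ge0// ltW.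
- have pgt1 : (1 < p)%R by rewrite lt_neqAle eq_sym pn1.
  have q0 : (0 < p - 1)%R by rewrite subr_gt0.
  pose sigma x := (w x `^ (p - 1)^-1)^-1.
  pose s := (tau `^ (p - 1)^-1)^-1%R.
  have s0 : (0 < s)%R by rewrite invr_gt0 powR_gt0.
  (* s is the value of the dual weight on {w = tau} *)
  have mk : s%:E * y%:E <= choquet H (cube a l) sigma.
    apply: le_trans (choquet_markov capH _ _ s0).
    apply: lee_wpmul2l; first by rewrite lee_fin ltW.
    rewrite -yE; apply: cap_le => // x [Qx wx]; split => //.
    rewrite /sigma; case wxE : (w x) (w0 x) wx => [u| |]//=.
    rewrite lee_fin lte_fin => u0 ut; rewrite inver; case: ifPn => [|un].
      by rewrite ltry.
    have u0' : (0 < u)%R.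
      rewrite lt_neqAle u0 andbT eq_sym; apply: contraNneq un => ->.
      by rewrite powR0// gt_eqF// invr_gt0.
    rewrite lte_fin /s ltf_pV2 ?posrE ?powR_gt0//.
    by apply: gt0_ltr_powR => //; rewrite ?invr_gt0// nnegrE// ltW.
  have avg_le : (s * y / h)%:E <= cube_average delta a l sigma.
    rewrite /cube_average hE inver gt_eqF// mulrC EFinM.
    by apply: lee_wpmul2l; rewrite ?lee_fin ?invr_ge0 ?(ltW h0)// EFinM.
  have : (v / h)%:E * (s * y / h)%:E `^ (p - 1) <= M%:E.
    rewrite -ME; apply: ereal_sup_ge.
    exists (cube_average delta a l w * cube_average delta a l sigma `^ (p - 1)).
      by exists a, l; split.
    rewrite avgE; apply: lee_wpmul2l; first by rewrite lee_fin divr_ge0// ltW.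
    apply: gt0_ler_poweR => //; first exact: ltW.
    + rewrite in_itv/= leey lee_fin andbT.
      by rewrite divr_ge0 ?mulr_ge0 ?(ltW s0) ?(ltW h0).
    + by rewrite in_itv/= leey cube_average_ge0.
  rewrite /= -EFinM lee_fin -[(s * y / h)%R]mulrA.
  rewrite [((s * (y / h)) `^ (p - 1))%R]powRM ?(ltW s0)//.
  have -> : (s `^ (p - 1) = tau^-1)%R.
    by rewrite /s -powRN -powRrM mulNr mulVf ?gt_eqF// powR_inv1// ltW.
  move=> key.
  have {}key : (v / h * (y / h) `^ (p - 1) <= tau * M)%R.
    move: key; rewrite mulrCA mulrC ler_pdivrMr// => /le_trans; apply.
    by rewrite mulrC.
  (* the exponent p - 1 can be raised to p because y / h <= 1 *)
  apply: le_trans key; apply: ler_wpM2l; first by rewrite divr_ge0// ltW.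
  have [yE0|yn] := eqVneq (y / h)%R 0%R.
    by rewrite yE0 !powR0// gt_eqF// (lt_trans _ pgt1).
  apply: ger_powR; last by rewrite gerBl.
  by rewrite r1 andbT lt_neqAle eq_sym yn.
Qed.

(** By Markov's inequality {w > 2A} fills at most half of the cube, A being the
    average of w, so {w < 3A} fills at least half of it; then
    muckenhoupt_sublevel with tau = 3A bounds M from below. *)
Lemma muckenhoupt_const_lower_bound a l h v M : (0 < l)%R ->
  muckenhoupt_const delta p w = M%:E ->
  H (cube a l) = h%:E -> (0 < h)%R ->
  W (cube a l) = v%:E -> (0 < v)%R ->
  (1 <= 6 * M `^ p^-1)%R.
Proof.
move=> l0 ME hE h0 vE v0.
have M0 : (0 <= M)%R by rewrite -lee_fin -ME muckenhoupt_const_ge0.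
have p0 : (0 < p)%R by exact: lt_le_trans p1.
pose A := (v / h)%R; have A0 : (0 < A)%R by rewrite divr_gt0.
pose S := [set x | cube a l x /\ w x < (3 * A)%:E].
have [y yE] : exists y, H S = y%:E.
  exists (fine (H S)); rewrite fineK// ge0_fin_numE ?cap_ge0//.
  by apply: le_lt_trans (hcontent_cube_lty a l0); apply: cap_le => // x [].
have tau0 : (0 < 3 * A)%R by rewrite mulr_gt0.
have sub := muckenhoupt_sublevel l0 ME hE h0 vE v0 tau0 yE.
have A20 : (0 < 2 * A)%R by rewrite mulr_gt0.
have big : H [set x | cube a l x /\ (2 * A)%:E < w x] <= (h / 2)%:E.
  have := choquet_markov capH (cube a l) w A20.
  rewrite -/(W _) vE -lee_pdivlMl// -EFinM => /le_trans; apply.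
  by rewrite lee_fin /A le_eqVlt; apply/orP; left; apply/eqP; field; rewrite !gt_eqF.
have yh : (1 / 2 <= y / h)%R.
  rewrite ler_pdivlMr//.
  have : H (cube a l) <= y%:E + (h / 2)%:E.
    rewrite -yE; apply: le_trans (leeD2l _ big).
    apply: le_trans (cap_setU capH _ _); apply: cap_le => // x Qx.
    have [wx|wx] := ltP (w x) (3 * A)%:E; [by left|right; split => //].
    by apply: lt_le_trans wx; rewrite lte_fin ltr_pM2r// ltr_nat.
  by rewrite hE -EFinD lee_fin; lra.
have : ((1 / 2) `^ p <= 3 * M)%R.
  apply: (@le_trans _ _ ((y / h) `^ p)%R).
    by apply: ge0_ler_powR => //; rewrite ?nnegrE ?ltW// (lt_le_trans _ yh).
  rewrite -(ler_pM2l A0); apply: le_trans sub _.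
  by rewrite -mulrA [leRHS]mulrCA.
move=> /(@ge0_ler_powR R p^-1); rewrite invr_ge0 (ltW p0) => /(_ isT).
rewrite !nnegrE powR_ge0 mulr_ge0// => /(_ isT isT).
rewrite -powRrM mulfV ?gt_eqF// powRr1 ?divr_ge0// powRM//.
have : ((3 : R) `^ p^-1 <= 3)%R.
  rewrite -[leRHS]powRr1//; apply: ler_powR; first by rewrite ler1n.
  by rewrite invf_le1.
move=> h3; have : ((3 : R) `^ p^-1 * M `^ p^-1 <= 3 * M `^ p^-1)%R.
  by apply: ler_wpM2r => //; exact: powR_ge0.
lra.
Qed.

Let W_sublevel_ni E c s t : (0 < c)%R -> (0 < s)%R -> (s <= t)%R ->
  W [set x | E x /\ w x < (c / t)%:E] <= W [set x | E x /\ w x < (c / s)%:E].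
Proof.
move=> c0 s0 st; apply: cap_le => // x [Ex wx]; split => //.
apply: lt_le_trans wx _; rewrite lee_fin ler_pM2l// lef_pV2// posrE.
exact: lt_le_trans st.
Qed.

Let W_sublevel_ge0 E c t : 0 <= W [set x | E x /\ w x < (c / t)%:E].
Proof. exact: cap_ge0. Qed.

(** For t <= b := c / A the integrand is bounded by W(Q), for t > b by c / t
    times the content of a sublevel set, which muckenhoupt_sublevel makes
    integrable at infinity. *)
Lemma reciprocal_integral_cube a l M c : (0 < l)%R ->
  muckenhoupt_const delta p w = M%:E -> (0 < c)%R ->
  \int[lebesgue_measure]_(t in `]0%R, +oo[)
    W [set x | cube a l x /\ w x < (c / t)%:E] <=
  ((6 + p) * M `^ p^-1 * c)%:E * H (cube a l).
Proof.
move=> l0 ME c0.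
have p0 : (0 < p)%R by exact: lt_le_trans p1.
have M0 : (0 <= M)%R by rewrite -lee_fin -ME muckenhoupt_const_ge0.
have B0 : (0 <= (6 + p) * M `^ p^-1 * c)%R.
  by rewrite !mulr_ge0 ?powR_ge0 ?addr_ge0// ltW.
have [h hE] : exists h, H (cube a l) = h%:E.
  exists (fine (H (cube a l))).
  by rewrite fineK// ge0_fin_numE ?cap_ge0// hcontent_cube_lty.
have [v vE] : exists v, W (cube a l) = v%:E.
  exists (fine (W (cube a l))).
  by rewrite fineK// ge0_fin_numE ?cap_ge0// weighted_content_cube_lty.
have h0 : (0 <= h)%R by rewrite -lee_fin -hE cap_ge0.
have v0 : (0 <= v)%R by rewrite -lee_fin -vE cap_ge0.
rewrite hE; move: h0; rewrite le_eqVlt => /predU1P[h0|h0].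
  rewrite -h0 mule0; rewrite integral0_eq// => t _.
  apply/eqP; rewrite eq_le W_sublevel_ge0 andbT.
  rewrite -[leRHS](choquet_null_set w capH (_ : H (cube a l) = 0));
    last by rewrite hE -h0.
  by apply: (cap_le capW) => x [].
move: v0; rewrite le_eqVlt => /predU1P[v0|v0].
  rewrite integral0_eq; first by rewrite mule_ge0// lee_fin// ltW.
  move=> t _; apply/eqP; rewrite eq_le W_sublevel_ge0 andbT.
  have -> : 0 = W (cube a l) by rewrite vE -v0.
  by apply: (cap_le capW) => x [].
pose b := (c * h / v)%R.
have b0 : (0 < b)%R by rewrite divr_gt0// mulr_gt0.
rewrite (integral_posR_split b0) //; last by move=> s t; exact: W_sublevel_ni.
have head : \int[lebesgue_measure]_(t in `]0%R, b])
    W [set x | cube a l x /\ w x < (c / t)%:E] <= (c * h)%:E.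
  apply: (@le_trans _ _ (b%:E * v%:E)).
    apply: integral_itv0_le => //; first by move=> s t; exact: W_sublevel_ni.
    by move=> t _ _; rewrite -vE; apply: (cap_le capW) => x [].
  by rewrite -EFinM lee_fin /b divfK// gt_eqF.
pose k := (c * h * M `^ p^-1 * b `^ p^-1)%R.
have k0 : (0 <= k)%R by rewrite !mulr_ge0 ?powR_ge0 ?(ltW c0) ?(ltW h0).
have ptail t : (0 < t)%R -> W [set x | cube a l x /\ w x < (c / t)%:E] <=
    k%:E * (t `^ (- p^-1 - 1))%R%:E.
  move=> t0; have tau0 : (0 < c / t)%R by rewrite divr_gt0.
  set S := [set x | _].
  have [y yE] : exists y, H S = y%:E.
    exists (fine (H S)); rewrite fineK// ge0_fin_numE ?cap_ge0//.
    by apply: le_lt_trans (hcontent_cube_lty a l0); apply: cap_le => // x [].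
  have y0 : (0 <= y)%R by rewrite -lee_fin -yE cap_ge0.
  apply: le_trans (weighted_content_le_cst tau0 _) _.
    by move=> x [_ /ltW].
  rewrite yE -!EFinM lee_fin.
  have sub := muckenhoupt_sublevel l0 ME hE h0 vE v0 tau0 yE.
  have yh0 : (0 <= y / h)%R by rewrite divr_ge0// ltW.
  have : ((y / h) `^ p <= M * b * t^-1)%R.
    rewrite -(@ler_pM2l _ (v / h)%R) ?divr_gt0//; apply: le_trans sub _.
    rewrite le_eqVlt; apply/orP; left; apply/eqP; rewrite /b.
    by field; rewrite !gt_eqF.
  move=> /(@ge0_ler_powR R p^-1); rewrite invr_ge0 (ltW p0) => /(_ isT).
  have Mb0 : (0 <= M * b)%R by rewrite mulr_ge0// ltW.
  have tV0 : (0 <= t^-1)%R by rewrite invr_ge0 ltW.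
  rewrite !nnegrE powR_ge0 (mulr_ge0 Mb0 tV0) => /(_ isT isT).
  rewrite -powRrM mulfV ?gt_eqF// powRr1//.
  rewrite [((M * b * t^-1) `^ _)%R]powRM//.
  rewrite [((M * b) `^ _)%R]powRM ?(ltW b0)// => yle.
  have tE : (t `^ (- p^-1 - 1) = t^-1 * t^-1 `^ p^-1)%R.
    rewrite powRD; last by apply/implyP => _; rewrite gt_eqF.
    rewrite powR_inv1 ?ltW// mulrC powRN; congr (_ * _)%R.
    by rewrite -[(t^-1)%R]powR_inv1 ?(ltW t0)// -powRrM mulN1r powRN.
  rewrite tE; move: yle; rewrite ler_pdivrMr// => yle.
  have ct : (0 <= c / t)%R by exact: ltW.
  apply: le_trans (ler_wpM2l ct yle) _.
  by rewrite /k le_eqVlt; apply/orP; left; apply/eqP; ring.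
have tail : \int[lebesgue_measure]_(t in `]b, +oo[)
    W [set x | cube a l x /\ w x < (c / t)%:E] <= (c * h * M `^ p^-1 * p)%:E.
  have mg : measurable_fun `[b, +oo[ (fun t : R => (t `^ (- p^-1 - 1))%R%:E).
    apply/measurable_EFinP; apply: measurable_funTS.
    exact: measurable_powR.
  apply: (@le_trans _ _ (\int[lebesgue_measure]_(t in `]b, +oo[)
     (k%:E * (t `^ (- p^-1 - 1))%R%:E))).
    apply: ge0_le_integral => //.
    - have sub : `]b, +oo[%classic `<=` `]0%R, +oo[%classic.
        by move=> t /=; rewrite !in_itv/= !andbT; exact: lt_trans.
      apply: (measurable_funS _ sub (measurable_nonincreasing_posR
        (phi := fun t => W [set x | cube a l x /\ w x < (c / t)%:E]) _)) => //.
      by move=> s t; exact: W_sublevel_ni.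
    - have sub : `]b, +oo[%classic `<=` `[b, +oo[%classic.
        by move=> t /=; rewrite !in_itv/= !andbT; exact: ltW.
      by apply: measurable_funeM; exact: (measurable_funS _ sub mg).
    - by move=> t /=; rewrite in_itv/= andbT => bt; apply: ptail; exact: lt_trans bt.
  apply: (@le_trans _ _ (\int[lebesgue_measure]_(t in `[b, +oo[)
     (k%:E * (t `^ (- p^-1 - 1))%R%:E))).
    apply: ge0_subset_integral => //.
    - exact: measurable_funeM.
    - by move=> t _; rewrite mule_ge0// lee_fin ?powR_ge0.
    - by move=> t /=; rewrite !in_itv/= !andbT => /ltW.
  rewrite ge0_integralZl//; last by move=> t _; rewrite lee_fin powR_ge0.
  rewrite integral_powR_tail ?invr_gt0// -EFinM lee_fin invrK /k powRN.
  have bp : (b `^ p^-1 != 0)%R by rewrite gt_eqF// powR_gt0.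
  by rewrite le_eqVlt; apply/orP; left; apply/eqP; field.
apply: le_trans (leeD head tail) _.
rewrite -EFinD -EFinM lee_fin.
have low := muckenhoupt_const_lower_bound l0 ME hE h0 vE v0.
have ch : (0 <= c * h)%R by rewrite mulr_ge0// ltW.
have := ler_wpM2l ch low; lra.
Qed.

(** Both sides pass from cubes to arbitrary sets: the left one is countably
    subadditive in E, and the right one is an infimum over coverings.  Finiteness
    of the content provides at least one covering, which settles the degenerate
    case where the constant vanishes. *)
Lemma reciprocal_integral E M c : muckenhoupt_const delta p w = M%:E ->
  (0 < c)%R -> H E < +oo ->
  \int[lebesgue_measure]_(t in `]0%R, +oo[)
    W [set x | E x /\ w x < (c / t)%:E] <=
  ((6 + p) * M `^ p^-1 * c)%:E * H E.
Proof.
move=> ME c0 Hoo; set B := ((6 + p) * M `^ p^-1 * c)%R.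
have p0 : (0 < p)%R by exact: lt_le_trans p1.
have B0 : (0 <= B)%R by rewrite !mulr_ge0 ?powR_ge0 ?addr_ge0// ltW.
set L := (X in X <= _).
have cover s : [set s | exists (I : set nat) (a : nat -> 'rV[R]_n) (l : nat -> R),
    [/\ (forall i, I i -> (0 < l i)%R), E `<=` \bigcup_(i in I) cube (a i) (l i) &
        s = \esum_(i in I) (l i `^ delta)%:E]] s -> L <= B%:E * s.
  move=> [I [a [l [l0 Eal ->]]]].
  pose Q i := [set x | I i /\ cube (a i) (l i) x].
  pose F i t := [set x | Q i x /\ w x < (c / t)%:E].
  have LF : L <= \sum_(0 <= i <oo) \int[lebesgue_measure]_(t in `]0%R, +oo[) W (F i t).
    apply: (le_integral_nneseries (psi := fun i t => W (F i t))).
    - by [].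
    - by move=> s' t; exact: W_sublevel_ni.
    - by move=> i t; exact: W_sublevel_ge0.
    - by move=> i s' t; exact: W_sublevel_ni.
    move=> t _; apply: le_trans (cap_bigcup capW _); apply: cap_le => // x [Ex wx].
    by have [i Ii Qx] := Eal _ Ex; exists i.
  rewrite esum_mkcond -nneseries_esumT; last first.
    by move=> i; case: ifP => // _; rewrite lee_fin powR_ge0.
  rewrite -nneseriesZl; last first.
    by move=> i _; case: ifP => // _; rewrite lee_fin powR_ge0.
  apply: (le_trans LF); apply: lee_nneseries => i.
    by move=> _ _; apply: integral_ge0 => t _; exact: W_sublevel_ge0.
  move=> _; case: ifPn => [/set_mem Ii|/negP nIi].
    apply: (@le_trans _ _ (B%:E * H (cube (a i) (l i)))).
      have := reciprocal_integral_cube (a i) (l0 _ Ii) ME c0; apply: le_trans.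
      apply: le_integral_nonincreasing.
      + by move=> t; exact: W_sublevel_ge0.
      + by move=> s' t; exact: W_sublevel_ni.
      + by move=> s' t; exact: W_sublevel_ni.
      by move=> t _; apply: (cap_le capW) => x [[]].
    by apply: lee_wpmul2l; rewrite ?lee_fin// hcontent_cube// l0.
  rewrite mule0 integral0_eq// => t _.
  rewrite (_ : F i t = set0) ?(cap_set0 capW)//.
  by apply/seteqP; split => // x [[Ii]]; case: nIi; rewrite inE.
move: B0; rewrite le_eqVlt => /predU1P[B0|B0].
  have [s Ss _] := ereal_inf_ltP Hoo.
  by have := cover s Ss; rewrite -B0 !mul0e.
rewrite -lee_pdivrMl//; apply/ereal_infP => s Ss.
by rewrite lee_pdivrMl//; exact: cover.
Qed.
End CubeEstimates.

Theorem proposition2p7 (R : realType) (p : R) (hp : (1 <= p)%R) :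
  exists2 K : R, (0 < K)%R &
    forall (n : nat) (delta : R) (w : 'rV[R]_n -> \bar R),
      (0 < delta <= n%:R)%R ->
      muckenhoupt delta p w ->
      forall f : 'rV[R]_n -> \bar R, weighted_L1 delta w f ->
        (4^-1)%:E * choquet (hcontent delta) setT (fun x => `|f x| * w x)
          <= choquet (weighted_content delta w) setT (fun x => `|f x|)
        /\
        choquet (weighted_content delta w) setT (fun x => `|f x|)
          <= K%:E * muckenhoupt_const delta p w `^ p^-1 *
             choquet (hcontent delta) setT (fun x => `|f x| * w x).
Proof.
have p0 : (0 < p)%R by exact: lt_le_trans hp.
exists (4 * (6 + p))%R; first by rewrite mulr_gt0 ?addr_gt0.
move=> n delta w _ [capw Moo] f fL1.
have capH := @hcontent_capacity R n delta.
have [w0 _ w_ae] := capw.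
have f0 x : 0 <= `|f x| by exact: abse_ge0.
split.
  rewrite lee_pdivrMl//.
  exact: (choquet_product_le_iterated capH w0 f0).
have M0 := muckenhoupt_const_ge0 delta p w.
have [M ME] : exists M, muckenhoupt_const delta p w = M%:E.
  exists (fine (muckenhoupt_const delta p w)).
  by rewrite fineK// ge0_fin_numE.
rewrite ME /= -EFinM -mulrA.
apply: (choquet_iterated_le_product capH w0 f0) => //.
  by rewrite mulr_ge0 ?powR_ge0// addr_ge0// ltW.
by move=> E c c0 EHoo; exact: (reciprocal_integral hp capw ME c0 EHoo).
Qed.
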